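(* Let $\Pi=E_{\rm tot}+E_{\rm ext}$ be the potential energy of a general atomistic system described by its degrees of freedom $\boldsymbol{u}\in\mathbb{R}^N$. Let $\boldsymbol{u}^0$ be a lattice that is uniform in the sense that it is in equilibrium with respect to $\Pi$, i.e. $\boldsymbol{u}^0$ is a critical point of $\Pi$: $\frac{\partial\Pi}{\partial u_i}(\boldsymbol{u}^0)=0$ for $i=1,\dots,N$. Let the QC approximation, with reconstruction matrix $U^{\rm QC}$, be chosen so that there exists a QC vector $\boldsymbol{u}^{0,{\rm QC}}\in\mathbb{R}^K$ with $\boldsymbol{u}^0=U^{\rm QC}\boldsymbol{u}^{0,{\rm QC}}$. Then $\boldsymbol{u}^{0,{\rm QC}}$ is a QC solution, i.e. it is a critical point of the function $\Pi^{\rm QCP}(\boldsymbol{u}^{\rm QC})=\Pi(U^{\rm QC}\boldsymbol{u}^{\rm QC})$: $$\frac{\partial \Pi^{\rm QCP}}{\partial u_{i_k}}(\boldsymbol{u}^{0,{\rm QC}})=0\qquad(1\le k\le K).$$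
   Context: The degrees of freedom $\boldsymbol{u}=(u_1,\dots,u_N)$ are the coordinates of the atoms. The potential energy $\Pi(\boldsymbol{u})=E_{\rm tot}(\boldsymbol{u})+E_{\rm ext}(\boldsymbol{u})$ is a real-valued function, defined on an open subset of $\mathbb{R}^N$ containing $\boldsymbol{u}^0$ and differentiable there; $E_{\rm tot}$ is the internal energy of the atoms and $E_{\rm ext}$ is a linear functional of $\boldsymbol{u}$. QC approximation: one selects $K$ nodal degrees of freedom with indices $i_1,\dots,i_K\in\{1,\dots,N\}$, and the QC variables are $\boldsymbol{u}^{\rm QC}=[u_{i_1},\dots,u_{i_K}]\in\mathbb{R}^K$. The QC reconstruction matrix $U^{\rm QC}$ is a real $N\times K$ matrix which expresses all degrees of freedom through the nodal ones (for example by linear interpolation), $\boldsymbol{u}=U^{\rm QC}\boldsymbol{u}^{\rm QC}$; in particular it reproduces the nodal values, $(U^{\rm QC}\boldsymbol{v})_{i_k}=v_k$ for $\boldsymbol{v}\in\mathbb{R}^K$. The quasicontinuum projection (QCP) energy is $\Pi^{\rm QCP}(\boldsymbol{u}^{\rm QC})=\Pi(U^{\rm QC}\boldsymbol{u}^{\rm QC})$, regarded as a function of the $K$ nodal variables, and a QC solution (for the QCP method) is a critical point of $\Pi^{\rm QCP}$. *)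

(* Defs.v *)
From mathcomp Require Import all_boot all_order all_algebra.
From mathcomp Require Import all_classical all_reals all_analysis.
Set Implicit Arguments.
Unset Strict Implicit.
Unset Printing Implicit Defensive.
Import Order.TTheory GRing.Theory Num.Theory.
Import numFieldNormedType.Exports.
Local Open Scope classical_set_scope.
Local Open Scope ring_scope.

Definition total_potential (R : realType) (N : nat) (Etot : 'cV[R]_N -> R)
    (Eext : {linear 'cV[R]_N -> R^o}) (u : 'cV[R]_N) : R :=
  Etot u + Eext u.

(* Functions on an open set D are represented by total functions whose values
   outside D are irrelevant; hence a critical point is required to lie in D.
   [is_derive] asserts both that the partial derivative exists and its value;
   [delta_mx i 0] is the i-th vector of the standard basis. *)
Definition critical_point (R : realType) (n : nat) (D : set 'cV[R]_n)
    (f : 'cV[R]_n -> R) (x : 'cV[R]_n) : Prop :=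
  D x /\ forall i : 'I_n, is_derive x (delta_mx i 0) f 0.

Definition nodal_values (R : realType) (N K : nat) (idx : 'I_K -> 'I_N)
    (u : 'cV[R]_N) : 'cV[R]_K :=
  \col_k u (idx k) 0.

(* Reproduction of the nodal values forces [idx] to be injective, i.e. the
   nodal indices to be pairwise distinct. *)
Definition reconstruction_matrix (R : realType) (N K : nat)
    (idx : 'I_K -> 'I_N) (U : 'M[R]_(N, K)) : Prop :=
  forall v : 'cV[R]_K, nodal_values idx (U *m v) = v.

Definition qcp_energy (R : realType) (N K : nat) (U : 'M[R]_(N, K))
    (Pi : 'cV[R]_N -> R) (v : 'cV[R]_K) : R :=
  Pi (U *m v).

Definition qcp_domain (R : realType) (N K : nat) (U : 'M[R]_(N, K))
    (D : set 'cV[R]_N) : set 'cV[R]_K :=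
  [set v | D (U *m v)].

Definition qc_solution (R : realType) (N K : nat) (U : 'M[R]_(N, K))
    (D : set 'cV[R]_N) (Pi : 'cV[R]_N -> R) (v : 'cV[R]_K) : Prop :=
  critical_point (qcp_domain U D) (qcp_energy U Pi) v.

(* Main.v *)
Require Import Defs.
From mathcomp Require Import all_boot all_order all_algebra.
From mathcomp Require Import all_classical all_reals all_analysis.
Import Order.TTheory GRing.Theory Num.Theory.
Import numFieldNormedType.Exports.
Local Open Scope classical_set_scope.
Local Open Scope ring_scope.

(** The chain rule gives the gradient of the projected energy at a vector [v]
    as the transpose of [U] applied to the gradient of the full energy at
    [U *m v]; when the latter vanishes, so does the former.  In terms of
    directional derivatives: moving the nodal variables from [v] along [e] moves
    the atoms from [U *m v] along [U *m e], so the two energies have the same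
    directional derivatives there ([is_derive_comp_mulmx]).  The direction
    [U *m e] is in general not a coordinate direction.  This is where
    differentiability of the energy enters: it makes the directional derivative
    linear in the direction, so that vanishing partial derivatives force all
    directional derivatives to vanish
    ([is_derive0_of_partial_derivatives0]). *)

(** Since [U *m (h *: e + v) = h *: (U *m e) + U *m v], both derivatives are the
    limit of one and the same difference quotient. *)
Lemma is_derive_comp_mulmx (R : realType) (N K : nat) (U : 'M[R]_(N, K))
    (f : 'cV[R]_N -> R) (v e : 'cV[R]_K) (l : R) :
  is_derive (U *m v) (U *m e) f l -> is_derive v e (fun w => f (U *m w)) l.
Proof.
have quotientE : (fun h : R => h^-1 *: ((f \o shift (U *m v)) (h *: (U *m e))
                                - f (U *m v) : R^o))
    = (fun h : R => h^-1 *: (((fun w => f (U *m w)) \o shift v) (h *: e)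
                     - f (U *m v) : R^o)).
  by apply/funext => h /=; rewrite mulmxDr scalemxAr.
case=> df dfE; split.
- by move: df; rewrite /derivable quotientE.
- by move: dfE; rewrite /derive quotientE.
Qed.

(** The differential of [f] at [x] is linear and computes the derivative in
    every direction, so it is determined by its values on the standard basis. *)
Lemma is_derive0_of_partial_derivatives0 (R : realType) (n : nat)
    (f : 'cV[R]_n -> R) (x w : 'cV[R]_n) :
  differentiable f x -> (forall i, is_derive x (delta_mx i 0) f 0) ->
  is_derive x w f 0.
Proof.
move=> df partial0; apply: DeriveDef; first exact: diff_derivable.
rewrite deriveE // (matrix_sum_delta w) linear_sum big1 // => i _.
rewrite linear_sum big1 // => j _.
by rewrite (ord1 j) linearZ /= -deriveE // derive_val scaler0.
Qed.

Theorem theorem2 (R : realType) (N K : nat)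
  (D : set 'cV[R]_N)
  (Etot : 'cV[R]_N -> R) (Eext : {linear 'cV[R]_N -> R^o})
  (idx : 'I_K -> 'I_N) (U : 'M[R]_(N, K))
  (u0 : 'cV[R]_N) (u0QC : 'cV[R]_K)
  (openD : open D)
  (diffPi : forall u : 'cV[R]_N, D u ->
     differentiable (total_potential Etot Eext) u)
  (u0_critical : critical_point D (total_potential Etot Eext) u0)
  (U_reconstruction : reconstruction_matrix idx U)
  (u0_QC : u0 = U *m u0QC) :
  qc_solution U D (total_potential Etot Eext) u0QC.
Proof.
case: u0_critical => Du0 partial0; rewrite u0_QC in Du0 partial0.
split=> // k; apply: is_derive_comp_mulmx.
by apply: is_derive0_of_partial_derivatives0 => //; exact: diffPi.
Qed.
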